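(* Let $\Phi$ be a Leonard system over $\mathbb F$ of type II, with eigenvalue sequence $\{\theta_i\}_{i=0}^d$, dual eigenvalue sequence $\{\theta^*_i\}_{i=0}^d$, and scalars $a,b,c,a^*,b^*,c^*\in\mathbb F$ with $\theta_i=a+b(i-d/2)+ci(d-i)$ and $\theta^*_i=a^*+b^*(i-d/2)+c^*i(d-i)$ for $0\le i\le d$. Let $\{\varphi_i\}_{i=1}^d$, $\{\phi_i\}_{i=1}^d$ be the first and second split sequences of $\Phi$, and let $t\in\overline{\mathbb F}$ be such that for $1\le i\le d$ $$\varphi_i=i(d-i+1)\Bigl(t-\tfrac{bb^*}{2}+(bc^*+cb^* )\bigl(i-\tfrac{d+1}{2}\bigr)-cc^*\bigl(i-\tfrac{d+1}{2}\bigr)^2\Bigr),$$ $$\phi_i=i(d-i+1)\Bigl(t+\tfrac{bb^*}{2}+(cb^*-bc^* )\bigl(i-\tfrac{d+1}{2}\bigr)-cc^*\bigl(i-\tfrac{d+1}{2}\bigr)^2\Bigr).$$ Let $\hat P$ be the normalized Drinfel'd polynomial of $\Phi$. (i) Assume $cc^*\ne0$, and let $\psi\in\overline{\mathbb F}$ be a solution of $\psi^2=4tcc^*+b^2c^{*2}+b^{*2}c^2$. Then the roots of $\hat P$ are $t+\psi\bigl(i-\tfrac{d+1}{2}\bigr)+cc^*\bigl(i-\tfrac{d+1}{2}\bigr)^2$ $(1\le i\le d)$. (ii) Assume $cc^*=0$. Then the roots of $\hat P$ are $t+(bc^*+cb^* )\bigl(i-\tfrac{d+1}{2}\bigr)$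 $(1\le i\le d)$.
   Context: Let $\mathbb F$ be a field, $\overline{\mathbb F}$ its algebraic closure, $V$ a vector space over $\mathbb F$ of finite positive dimension. A tridiagonal pair on $V$ is an ordered pair of $\mathbb F$-linear maps $A,A^*:V\to V$ ($A^*$ is just a name, not an adjoint) such that: (i) both are diagonalizable; (ii) the eigenspaces of $A$ can be ordered $V_0,\dots,V_d$ with $A^*V_i\subseteq V_{i-1}+V_i+V_{i+1}$ ($0\le i\le d$, $V_{-1}=V_{d+1}=0$); (iii) the eigenspaces of $A^*$ can be ordered $V^*_0,\dots,V^*_\delta$ with $AV^*_i\subseteq V^*_{i-1}+V^*_i+V^*_{i+1}$ ($0\le i\le\delta$, $V^*_{-1}=V^*_{\delta+1}=0$); (iv) no subspace $W\ne 0,V$ satisfies $AW\subseteq W$ and $A^*W\subseteq W$. It is known that $d=\delta$ (the diameter) and $\dim V_i=\dim V^*_i=\dim V_{d-i}$. Orderings as in (ii), (iii) are called standard. The pair is a Leonard pair if all $V_i$, $V_i^*$ have dimension 1. A tridiagonal system over $\mathbb F$ is a sequence $\Phi=(A;\{E_i\}_{i=0}^d;A^*;\{E^*_i\}_{i=0}^d)$ where $A,A^*$ is a tridiagonal pair and, for standard orderings of the eigenspaces, $E_i$ (resp. $E^*_i$) is the projection onto $V_i$ (resp. $V^*_i$) along the sum of the other eigenspaces. $\Phi$ is a Leonard system if $A,A^*$ is a Leonard pair. The eigenvalue sequence $\{\theta_i\}$ (dual eigenvalue sequence $\{\theta^*_i\}$) consists of the eigenvalues of $A$ on $E_iV$ (of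 $A^*$ on $E^*_iV$). For $\dim E^*_0V=1$, $E^*_0V$ is known to be invariant under $(A^*-\theta^*_1I)\cdots(A^*-\theta^*_iI)(A-\theta_{i-1}I)\cdots(A-\theta_0I)$ for $0\le i\le d$; $\zeta_i$ denotes the corresponding eigenvalue, and $\{\zeta_i\}_{i=0}^d$ is the split sequence of $\Phi$ ($\zeta_0=1$). Put $\Phi^\Downarrow=(A;\{E_{d-i}\}_{i=0}^d;A^*;\{E^*_i\}_{i=0}^d)$. For a Leonard system the split sequences of $\Phi$ and $\Phi^\Downarrow$ are known to have nonzero entries, and the first split sequence $\{\varphi_i\}_{i=1}^d$ (second split sequence $\{\phi_i\}_{i=1}^d$) is determined by the requirement that $\{\varphi_1\cdots\varphi_i\}_{i=0}^d$ (resp. $\{\phi_1\cdots\phi_i\}_{i=0}^d$) is the split sequence of $\Phi$ (resp. $\Phi^\Downarrow$). Base $\beta\in\mathbb F$: if $d\ge3$, the expressions $\frac{\theta_{i-2}-\theta_{i+1}}{\theta_{i-1}-\theta_i}$, $\frac{\theta^*_{i-2}-\theta^*_{i+1}}{\theta^*_{i-1}-\theta^*_i}$ are known to be equal and independent of $i$ for $2\le i\le d-1$, and $\beta+1$ is their common value; if $d\le2$, $\beta$ is any fixed nonzero scalar in $\mathbb F$. Type II means $\beta=2$ and $\mathrm{Char}(\mathbb F)\ne2$. For type II it is known that scalars $a,b,c,a^*,b^*,c^*$ as in the claim exist, that $\mathrm{Char}(\mathbb F)$ is $0$ or an odd prime greater than $d$, and that (for a Leonard system) a scalar $t$ as in the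 claim exists. Normalized Drinfel'd polynomial (type II): $\hat P=\sum_{i=0}^d\zeta_i\,\hat p_{i+1}\hat p_{i+2}\cdots\hat p_d\in\mathbb F[\lambda]$, where $\hat p_i=i^2\bigl(bb^*/2+(bc^*+cb^* )(d-i)+cc^*(d-i)^2-\lambda\bigr)$ for $1\le i\le d$. *)

(* Defs.v *)
From mathcomp Require Import all_boot all_order all_algebra.

Set Implicit Arguments.
Unset Strict Implicit.
Unset Printing Implicit Defensive.

Import GRing.Theory passmx.
Local Open Scope ring_scope.

Section TridiagonalPairs.

Variables (F : fieldType) (V : vectType F).
Implicit Types (A B As : 'End(V)) (d : nat).

Definition diagonalizable A : Prop :=
  exists s : seq F, (\sum_(a <- s) leigenspace A a)%VS = fullv.

(* [W] lists every eigenspace of [A] exactly once. *)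
Definition eigenspace_ordering A d (W : 'I_d.+1 -> {vspace V}) : Prop :=
  injective W /\
  forall U : {vspace V},
    (exists2 a, leigenvalue A a & U = leigenspace A a) <->
    (exists i, U = W i).

(* The sum ranges over the indices j of 'I_d.+1 with |i - j| <= 1, so that
   V_{-1} = V_{d+1} = 0 is built in. *)
Definition standard_ordering A B d (W : 'I_d.+1 -> {vspace V}) : Prop :=
  eigenspace_ordering A W /\
  forall i : 'I_d.+1,
    (B @: W i <= \sum_(j < d.+1 | (i <= j.+1)%N && (j <= i.+1)%N) W j)%VS.

Definition irreducible_pair A As : Prop :=
  forall W : {vspace V},
    (A @: W <= W)%VS -> (As @: W <= W)%VS -> W = 0%VS \/ W = fullv.

Definition tridiagonal_pair A As : Prop :=
  [/\ diagonalizable A /\ diagonalizable As,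
      exists d (W : 'I_d.+1 -> {vspace V}), standard_ordering A As W,
      exists d (W : 'I_d.+1 -> {vspace V}), standard_ordering As A W
    & irreducible_pair A As].

Definition leonard_pair A As : Prop :=
  [/\ tridiagonal_pair A As,
      forall a, leigenvalue A a -> \dim (leigenspace A a) = 1%N
    & forall a, leigenvalue As a -> \dim (leigenspace As a) = 1%N].

End TridiagonalPairs.

(* Raw data (A; {E_i}; A^*; {E^*_i}); the axioms are [tridiagonal_system]. *)
Record sysdata (F : fieldType) (V : vectType F) (d : nat) := SysData {
  sysA  : 'End(V);
  sysE  : 'I_d.+1 -> 'End(V);
  sysAs : 'End(V);
  sysEs : 'I_d.+1 -> 'End(V)
}.

Section TridiagonalSystems.

Variables (F : fieldType) (V : vectType F) (d : nat).
Implicit Types (Phi : sysdata V d) (theta thetas zeta : nat -> F).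

(* Sequences of scalars are functions on nat, of which only the values at
   indices at most d are ever constrained or used. *)

Definition primitive_idempotents (W : 'I_d.+1 -> {vspace V})
    (E : 'I_d.+1 -> 'End(V)) : Prop :=
  forall i, E i = daddv_pi (W i) (\sum_(j < d.+1 | j != i) W j)%VS.

Definition tridiagonal_system Phi : Prop :=
  [/\ tridiagonal_pair (sysA Phi) (sysAs Phi),
      exists2 W, standard_ordering (sysA Phi) (sysAs Phi) W
               & primitive_idempotents W (sysE Phi)
    & exists2 Ws, standard_ordering (sysAs Phi) (sysA Phi) Ws
                & primitive_idempotents Ws (sysEs Phi)].

Definition leonard_system Phi : Prop :=
  tridiagonal_system Phi /\ leonard_pair (sysA Phi) (sysAs Phi).

Definition down Phi : sysdata V d :=
  SysData (sysA Phi) (fun i => sysE Phi (rev_ord i)) (sysAs Phi) (sysEs Phi).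

Definition eigenvalue_sequence Phi theta : Prop :=
  forall i : 'I_d.+1, limg (sysE Phi i) = leigenspace (sysA Phi) (theta i).

Definition dual_eigenvalue_sequence Phi thetas : Prop :=
  forall i : 'I_d.+1, limg (sysEs Phi i) = leigenspace (sysAs Phi) (thetas i).

(* (A - x_{h_1} I) ... (A - x_{h_k} I) for hs = [:: h_1; ...; h_k] *)
Definition shift_prod (A : 'End(V)) (x : nat -> F) (hs : seq nat) : 'End(V) :=
  \big[(@comp_lfun F V V V)/(\1%VF)]_(h <- hs) (A - x h *: \1%VF).

(* (A^* - theta^*_1) ... (A^* - theta^*_i) (A - theta_{i-1}) ... (A - theta_0) *)
Definition split_op Phi theta thetas (i : nat) : 'End(V) :=
  (shift_prod (sysAs Phi) thetas (index_iota 1 i.+1) \o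
   shift_prod (sysA Phi) theta (rev (index_iota 0 i)))%VF.

Definition split_sequence Phi zeta : Prop :=
  exists theta thetas,
    [/\ eigenvalue_sequence Phi theta, dual_eigenvalue_sequence Phi thetas
      & forall i, (i <= d)%N -> forall v, v \in limg (sysEs Phi ord0) ->
          split_op Phi theta thetas i v = zeta i *: v].

Definition first_split_sequence Phi (phi : nat -> F) : Prop :=
  split_sequence Phi (fun i => \prod_(1 <= h < i.+1) phi h).

Definition second_split_sequence Phi (phi : nat -> F) : Prop :=
  split_sequence (down Phi) (fun i => \prod_(1 <= h < i.+1) phi h).

Definition is_base Phi (beta : F) : Prop :=
  exists theta thetas,
    [/\ eigenvalue_sequence Phi theta, dual_eigenvalue_sequence Phi thetas
      & if (3 <= d)%N then
          forall i, (2 <= i <= d.-1)%N ->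
            (theta (i - 2)%N - theta i.+1) / (theta (i - 1)%N - theta i)
              = beta + 1 /\
            (thetas (i - 2)%N - thetas i.+1) / (thetas (i - 1)%N - thetas i)
              = beta + 1
        else beta != 0].

Definition type_II Phi (beta : F) : Prop :=
  [/\ is_base Phi beta, beta = 2%:R & 2%N \notin [pchar F]].

End TridiagonalSystems.

Section DrinfeldPolynomial.

Variables (F : fieldType) (d : nat) (b c bs cs : F).

Definition phat (i : nat) : {poly F} :=
  i%:R ^+ 2 *: ((b * bs / 2%:R + (b * cs + c * bs) * (d%:R - i%:R)
                 + c * cs * (d%:R - i%:R) ^+ 2)%:P - 'X).

Definition drinfeld_poly (zeta : nat -> F) : {poly F} :=
  \sum_(0 <= i < d.+1) zeta i *: \prod_(i.+1 <= h < d.+1) phat h.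

End DrinfeldPolynomial.

Definition is_algebraic_closure (F : fieldType) (L : closedFieldType)
    (emb : {rmorphism F -> L}) : Prop :=
  forall x : L, algebraicOver emb x.

(* The roots of [p], counted with multiplicity, are the entries of [s]. *)
Definition roots_are (L : closedFieldType) (p : {poly L}) (s : seq L) : Prop :=
  p != 0 /\ forall x : L, mup x p = count_mem x s.

(* Main.v *)
Require Import Defs.
From mathcomp Require Import all_boot all_order all_algebra.
From mathcomp Require Import ring.

(** Why the theorem holds.  Write e = b b* / 2, s = b c* + c b*, k = c c*.
    Since zeta_i = varphi_1 ... varphi_i, and since
    i! d^_i (d^_(d-i))^2 = d!^2 C(d, i), pulling the integer factors out of
    varphi_h and of the normalized factors turns P into d!^2 times

      sum_i C(d, i) f(0) ... f(i-1) g(0) ... g(d-i-1),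

    where g(x) = e - X + s x + k x^2 and
    f(x) = t - e + s (x - m) - k (x - m)^2 with m = (d - 1) / 2
    ([split_sum_binomial_conv]).  This is a terminating balanced 3F2 at 1.
    Its sum is usually expressed through the roots of g, which depend on the
    variable X; but by the symmetry of the summation formula it is also the
    product of the values of g at gam, gam + 1, ..., gam + d - 1, where gam is
    the negative of a root of f ([saalschutz]).  When k != 0 such a gam is
    exactly what a square root psi of
    4 t k + b^2 c*^2 + b*^2 c^2 = 4 t k + s^2 - 4 e k provides:
    gam = (psi - s) / (2 k) - m, and centring g (gam + x) at m gives
    t - X + psi (x - m) + k (x - m)^2.  When k = 0 the series is a
    Chu-Vandermonde sum ([vandermonde]), and its value is given by the same
    expression with psi = s.

    The link with the Leonard system is twofold.  An eigenvalue sequence is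
    determined by the system, whence zeta_i = varphi_1 ... varphi_i
    ([split_sequence_unique]); and its entries are distinct
    ([eigenvalue_sequence_inj]), which forces i != 0 in the field for
    1 <= i <= d, because theta_i - theta_0 = i (b + c (d - i)).  Hence
    d! != 0, so that P is a nonzero multiple of the product found above. *)

Set Implicit Arguments.
Unset Strict Implicit.
Unset Printing Implicit Defensive.

Import GRing.Theory.
Local Open Scope ring_scope.

(** * Two terminating hypergeometric sums *)

Section Summation.
Variable R : comNzRingType.

(** The argument f is a function on the ring, not a sequence, so that it can
    also be taken along gam, gam + 1, ... *)
Definition nat_prod (n : nat) (f : R -> R) := \prod_(j < n) f j%:R.

Lemma nat_prodS n f : nat_prod n.+1 f = nat_prod n f * f n%:R.
Proof. exact: big_ord_recr. Qed.

Lemma nat_prod0 f : nat_prod 0 f = 1.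
Proof. exact: big_ord0. Qed.

(** With f x = u + x and g x = w + x this is the sum in the binomial theorem for
    rising factorials; polynomials f, g give unnormalized hypergeometric sums. *)
Definition binomial_conv (n : nat) (f g : R -> R) :=
  \sum_(i < n.+1) 'C(n, i)%:R * nat_prod i f * nat_prod (n - i) g.

(** Pascal's rule: both terms with lower index n share the product of i values
    of f and n - i values of g, and differ by one more value of g or of f. *)
Lemma binomial_convS n f g :
  binomial_conv n.+1 f g =
    \sum_(i < n.+1) 'C(n, i)%:R * nat_prod i f * nat_prod (n - i) g *
       (f i%:R + g (n%:R - i%:R)).
Proof.
have top : \sum_(i < n.+2) 'C(n, i)%:R * nat_prod i f * nat_prod (n.+1 - i) g =
    \sum_(i < n.+1) 'C(n, i)%:R * nat_prod i f * nat_prod (n - i) g *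
      g (n%:R - i%:R).
  rewrite big_ord_recr /= bin_small // !mul0r addr0.
  apply: eq_bigr => i _.
  by rewrite subSn ?leq_ord // nat_prodS natrB ?leq_ord // mulrA.
under [RHS]eq_bigr => i _ do rewrite mulrDr.
rewrite [RHS]big_split /= [RHS]addrC -top /binomial_conv.
rewrite big_ord_recl [in RHS]big_ord_recl /=.
rewrite !bin0 -addrA; congr (_ + _).
rewrite -big_split; apply: eq_bigr => i _ /=.
by rewrite /bump /= add1n binS subSS nat_prodS natrD; ring.
Qed.

(** For affine f and g of the same slope, f i + g (n - i) does not depend on i,
    so the Pascal recursion closes up. *)
Lemma vandermonde n (u w s : R) :
  binomial_conv n (fun x => u + s * x) (fun x => w + s * x) =
    nat_prod n (fun x => u + w + s * x).
Proof.
elim: n => [|n IHn]; first by rewrite /binomial_conv big_ord1 !nat_prod0 !mulr1.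
rewrite binomial_convS nat_prodS -IHn /binomial_conv big_distrl /=.
by apply: eq_bigr => i _; ring.
Qed.

(** The Pfaff-Saalschutz formula, free of division.  If
    g(x) = k (x + al) (x + be), the first function of the convolution is
    - k (x + gam) (x + de) with al + be + gam + de = 1 - n, the balancing
    condition.  The statement uses one root of that function and no root of g,
    so g may have coefficients in a polynomial ring.

    Let S_n be the left-hand side.  That S_(N+1) = g (gam + N) S_N holds because
    the difference of the i-th terms is T_i - T_(i+1) for an explicit T with
    T_0 = T_(N+1) = 0. *)
Lemma saalschutz n (gam w s k : R) :
  let g x := w + s * x + k * x ^+ 2 in
  binomial_conv n (fun x => (gam + x) * (s + k * (gam + n%:R - 1 - x))) g =
    nat_prod n (fun x => g (gam + x)).
Proof.
move=> g; elim: n => [|N IHN].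
  by rewrite /binomial_conv big_ord1 !nat_prod0 !mulr1.
rewrite binomial_convS nat_prodS -IHN; apply/eqP; rewrite -subr_eq0; apply/eqP.
rewrite /binomial_conv big_distrl -sumrB /=.
set f := fun x => _ * (_ + k * (gam + N.+1%:R - 1 - x)).
set f' := fun x => _ * (_ + k * (gam + N%:R - 1 - x)).
(* The second factors of f' are those of f shifted by one, so these products
   differ by a single second factor and a single first factor. *)
have fE i : nat_prod i.+1 f =
    (s + k * (gam + N%:R)) * (gam + i%:R) * nat_prod i f'.
  elim: i => [|i IHi]; first by rewrite nat_prodS !nat_prod0 /f -natr1; ring.
  by rewrite nat_prodS IHi nat_prodS /f /f' -!natr1; ring.
(* Gosper-style certificate; the occurrences of m.-1 and m - 1 at m = 0 are
   harmless because of the factor m. *)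
pose T m := k * m%:R * 'C(N, m)%:R * (gam + m%:R - 1) * nat_prod m.-1 f' *
  nat_prod (N.+1 - m) g.
have partial m : (m <= N.+1)%N ->
    \sum_(i < m) ('C(N, i)%:R * nat_prod i f * nat_prod (N - i) g *
        (f i%:R + g (N%:R - i%:R)) -
      'C(N, i)%:R * nat_prod i f' * nat_prod (N - i) g * g (gam + N%:R)) = - T m.
  elim: m => [|m IHm] le_m; first by rewrite big_ord0 /T mulr0 !mul0r oppr0.
  rewrite big_ord_recr /= {}IHm ?(ltnW le_m) // /T subSS subSn //= nat_prodS.
  have /(congr1 (fun p => p%:R : R)) := mul_bin_left N m.
  rewrite !natrM !natrB // => binE.
  have -> : k * m.+1%:R * 'C(N, m.+1)%:R * (gam + m.+1%:R - 1) =
      k * ((N%:R - m%:R) * 'C(N, m)%:R) * (gam + m%:R).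
    by rewrite -binE -natr1; ring.
  case: m le_m {binE} => [|m] le_m.
    by rewrite !nat_prod0 /f /g -natr1; ring.
  rewrite fE nat_prodS /f /f' /g -!natr1 /=; ring.
by rewrite partial // /T bin_small // mulr0 !mul0r oppr0.
Qed.
End Summation.

(** * Reduction of the Drinfel'd polynomial to such a sum *)

Section Centered.
Variable R : comNzRingType.

Lemma eq_nat_prod n (f g : R -> R) : f =1 g -> nat_prod n f = nat_prod n g.
Proof. by move=> fg; apply: eq_bigr => j _. Qed.

Lemma eq_binomial_conv n (f f' g g' : R -> R) :
  f =1 f' -> g =1 g' -> binomial_conv n f g = binomial_conv n f' g'.
Proof.
move=> ff' gg'; apply: eq_bigr => j _.
by rewrite (eq_nat_prod _ ff') (eq_nat_prod _ gg').
Qed.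

(** The formula in the variable x - m with m = (n - 1) / 2, in which its value
    is visibly a polynomial in psi; lam stands for 'X.  The equation on t says
    that the first function of the convolution vanishes at - gam. *)
Lemma saalschutz_centered n (e s k t psi m gam lam : R) :
  n%:R = 1 + 2%:R * m -> psi = s + 2%:R * k * (gam + m) ->
  t = e + s * m + k * m ^+ 2 + gam * (s + k * (gam + 2%:R * m)) ->
  binomial_conv n (fun x => t - e + s * (x - m) - k * (x - m) ^+ 2)
         (fun x => e - lam + s * x + k * x ^+ 2) =
    nat_prod n (fun x => t - lam + psi * (x - m) + k * (x - m) ^+ 2).
Proof.
move=> nE -> ->; have S := saalschutz n gam (e - lam) s k; rewrite /= in S.
transitivity (binomial_conv n
    (fun x => (gam + x) * (s + k * (gam + n%:R - 1 - x)))
    (fun x => e - lam + s * x + k * x ^+ 2)).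
  by apply: eq_binomial_conv => // x; rewrite nE; ring.
rewrite S.
by apply: eq_nat_prod => x; ring.
Qed.

Lemma prod_shift_fact i d (f : R -> R) : (i <= d)%N ->
  \prod_(1 <= h < i.+1) (h%:R * (d%:R - h%:R + 1) * f (h%:R - 1)) =
    (i`! * d ^_ i)%:R * nat_prod i f.
Proof.
elim: i => [|i IHi] le_id; first by rewrite big_geq // nat_prod0 mulr1.
rewrite big_nat_recr //= IHi ?(ltnW le_id) // nat_prodS factS ffactnSr !natrM.
by rewrite natrB ?(ltnW le_id) // -!natr1 addrK; ring.
Qed.

Lemma prod_rev_ffact m d (g : R -> R) : (m <= d)%N ->
  \prod_((d - m).+1 <= h < d.+1) (h%:R ^+ 2 * g (d%:R - h%:R)) =
    (d ^_ m)%:R ^+ 2 * nat_prod m g.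
Proof.
elim: m => [|m IHm] le_md.
  by rewrite subn0 big_geq // nat_prod0 ffactn0 expr1n mulr1.
rewrite subnSK // big_ltn; last by rewrite ltnS leq_subr.
rewrite IHm; last exact: ltnW.
rewrite nat_prodS ffactnSr natrM -[in g _]natrB ?leq_subr //.
by rewrite subKn ?(ltnW le_md) //; ring.
Qed.

(** The integer factors combine to
    i! d^_i (d^_(d-i))^2 = C(d, i) (C(d, i) i! (d-i)!)^2 = C(d, i) d!^2. *)
Lemma split_sum_binomial_conv d (f g : R -> R) :
  \sum_(0 <= i < d.+1)
    (\prod_(1 <= h < i.+1) (h%:R * (d%:R - h%:R + 1) * f (h%:R - 1))) *
    \prod_(i.+1 <= h < d.+1) (h%:R ^+ 2 * g (d%:R - h%:R)) =
  d`!%:R ^+ 2 * binomial_conv d f g.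
Proof.
rewrite big_mkord big_distrr; apply: eq_bigr => -[i /=]; rewrite ltnS => le_id _.
rewrite prod_shift_fact //.
have := prod_rev_ffact g (leq_subr i d); rewrite subKn // => ->.
rewrite -(bin_fact le_id) -!bin_ffact bin_sub //.
by rewrite !natrM; ring.
Qed.
End Centered.

Section Roots.
Variable K : fieldType.

(** In the case k = 0 the quadratic equation only gives psi = s or psi = - s;
    both choices yield the same roots, in opposite orders. *)
Lemma split_sum_factor d (e s k t psi : K) : 2%:R != 0 :> K ->
  k != 0 /\ psi ^+ 2 = 4%:R * t * k + s ^+ 2 - 4%:R * e * k \/
    k = 0 /\ psi = s ->
  \sum_(0 <= i < d.+1)
    (\prod_(1 <= h < i.+1) (h%:R * (d%:R - h%:R + 1) *
       (t - e + s * (h%:R - (d%:R + 1) / 2%:R)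
              - k * (h%:R - (d%:R + 1) / 2%:R) ^+ 2))) *:
    \prod_(i.+1 <= h < d.+1) (h%:R ^+ 2 *:
       ((e + s * (d%:R - h%:R) + k * (d%:R - h%:R) ^+ 2)%:P - 'X)) =
  (d`!%:R ^+ 2) *: \prod_(1 <= h < d.+1)
    ((t + psi * (h%:R - (d%:R + 1) / 2%:R)
        + k * (h%:R - (d%:R + 1) / 2%:R) ^+ 2)%:P - 'X).
Proof.
move=> nz2 kpsi; pose m : K := (d%:R - 1) / 2%:R.
pose F x := t%:P - e%:P + s%:P * (x - m%:P) - k%:P * (x - m%:P) ^+ 2.
pose G x := e%:P - 'X + s%:P * x + k%:P * x ^+ 2.
have mE (h : nat) : h%:R - (d%:R + 1) / 2%:R = h%:R - 1 - m by rewrite /m; field.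
transitivity (d`!%:R ^+ 2 * binomial_conv d F G).
  rewrite -split_sum_binomial_conv; apply: eq_bigr => i _; rewrite -mul_polyC.
  congr (_ * _); last first.
    apply: eq_bigr => h _; rewrite -mul_polyC /G; ring.
  rewrite rmorph_prod; apply: eq_bigr => h _; rewrite mE /F; ring.
rewrite -mul_polyC rmorphXn rmorph_nat; congr (_ * _).
transitivity (nat_prod d (fun x => t%:P - 'X + psi%:P * (x - m%:P)
                               + k%:P * (x - m%:P) ^+ 2)); last first.
  rewrite /nat_prod big_add1 big_mkord; apply: eq_bigr => h _.
  by rewrite mE -natr1; ring.
case: kpsi => [[nzk psiE]|[k0 ->]].
  (* The root of F attached to psi: k (gam + 2 m) + s and k gam are
     (psi + s) / 2 + k m and (psi - s) / 2 - k m. *)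
  pose gam := (psi - s) / (2%:R * k) - m.
  have nE : d%:R = 1 + 2%:R * m by rewrite /m; field.
  have psE : psi = s + 2%:R * k * (gam + m).
    by rewrite /gam; field; rewrite nzk nz2.
  have tE : t = e + s * m + k * m ^+ 2 + gam * (s + k * (gam + 2%:R * m)).
    have nz4 : 4%:R != 0 :> K by rewrite (natrM _ 2 2) mulf_neq0.
    have -> : t = (psi ^+ 2 - s ^+ 2 + 4%:R * e * k) / (4%:R * k).
      by rewrite psiE; field; rewrite nzk nz4.
    by rewrite /gam; field; rewrite nzk nz2.
  apply: (saalschutz_centered (gam := gam%:P)).
  - by have E := congr1 polyC nE; ring: E.
  - by have E := congr1 polyC psE; ring: E.
  - by have E := congr1 polyC tE; ring: E.
transitivity (binomial_conv d
    (fun x => (t%:P - e%:P - s%:P * m%:P) + s%:P * x)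
    (fun x => e%:P - 'X + s%:P * x)).
  by apply: eq_binomial_conv => x; rewrite /F /G k0 polyC0; ring.
by rewrite vandermonde; apply: eq_nat_prod => x; rewrite k0 polyC0; ring.
Qed.

End Roots.

Lemma roots_are_prod (L : closedFieldType) (I : Type) (c : L) (r : I -> L)
    (s : seq I) :
  c != 0 -> roots_are (c *: \prod_(i <- s) ((r i)%:P - 'X)) [seq r i | i <- s].
Proof.
move=> nzc.
have -> : \prod_(i <- s) ((r i)%:P - 'X) =
    ((-1) ^+ size s)%:P * \prod_(x <- map r s) ('X - x%:P).
  elim: s => [|i s IHs]; first by rewrite !big_nil mulr1.
  by rewrite /= !big_cons IHs exprS; ring.
rewrite -mul_polyC mulrA -polyCM.
have nzC : c * (-1) ^+ size s != 0 by rewrite mulf_neq0 ?signr_eq0.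
split; first by rewrite mulf_neq0 ?polyC_eq0 ?monic_neq0 ?monic_prod_XsubC.
by move=> x; rewrite mupMr ?mu_prod_XsubC // rootC.
Qed.

(** * Eigenvalue sequences and split sequences *)

Section Eigenspaces.
Import passmx.
Variables (F : fieldType) (V : vectType F).
Implicit Types (A B : 'End(V)).

Lemma mem_leigenspace A a v : (v \in leigenspace A a) = (A v == a *: v).
Proof. by rewrite memv_ker !lfun_simp subr_eq0. Qed.

(** Applying A - x_i to a vector u of both spaces multiplies u by a - x_i != 0
    and removes the i-th summand, whence an induction on the index list. *)
Lemma leigenspace_cap_sum A a I (r : seq I) (P : pred I) (x : I -> F) :
  (forall i, P i -> x i != a) ->
  (leigenspace A a :&: \sum_(i <- r | P i) leigenspace A (x i) = 0)%VS.
Proof.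
move=> xa; apply/eqP; rewrite -subv0; apply/subvP => u.
rewrite memv_cap memv0 mem_leigenspace => /andP[/eqP Au].
elim: r => [|i r IHr]; first by rewrite big_nil memv0.
rewrite big_cons; case: ifP => // Pi.
case/memv_addP => v; rewrite mem_leigenspace => /eqP Av [w w_sum uE].
apply: IHr; pose S := (\sum_(i <- r | P i) leigenspace A (x i))%VS.
rewrite -/S in w_sum *.
have Aw : A w \in S.
  have : (A @: S <= S)%VS.
    rewrite limg_sum; apply: (big_ind2 (fun U U' => (U <= U')%VS)) => //.
      by move=> U1 U1' U2 U2' s1 s2; apply: addvS.
    move=> j _; apply/subvP => _ /memv_imgP[z + ->].
    rewrite mem_leigenspace => /eqP Az.
    by rewrite Az memvZ // mem_leigenspace Az.
  by move/subvP; apply; apply: memv_img.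
suff: (a - x i) *: u \in S.
  by rewrite rpredZeq subr_eq0 eq_sym (negPf (xa i Pi)).
have -> : (a - x i) *: u = A w - x i *: w.
  by rewrite scalerBl -Au uE linearD /= Av scalerDr [x i *: v + A w]addrC addrKA.
by rewrite memvB // memvZ.
Qed.

(** The projection [daddv_pi] onto W i is onto only because the eigenspaces are
    independent. *)
Lemma limg_idempotent A d (W : 'I_d.+1 -> {vspace V}) (E : 'I_d.+1 -> 'End(V)) :
  eigenspace_ordering A W -> primitive_idempotents W E ->
  forall i, limg (E i) = W i /\ W i != 0%VS.
Proof.
move=> [injW Weig] EW i.
have /fin_all_exists[x xP] j : exists a, leigenvalue A a /\ W j = leigenspace A a.
  have [_ /(_ (ex_intro _ j erefl))[a aev Wa]] := Weig (W j).
  by exists a.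
split; last by have [evi ->] := xP i.
apply/eqP; rewrite EW eqEsubv; apply/andP; split.
  by apply/subvP => _ /memv_imgP[v _ ->]; exact: memv_pi.
apply/subvP => v vW; rewrite -(daddv_pi_id (V := \sum_(j | j != i) W j) _ vW).
  by rewrite memv_img ?memvf.
rewrite (proj2 (xP i)); under eq_bigr => j _ do rewrite (proj2 (xP j)).
apply: leigenspace_cap_sum => j; apply: contra_neq => xij.
by apply: injW; rewrite (proj2 (xP i)) (proj2 (xP j)) xij.
Qed.

Lemma leigenspace_inj A a b :
  leigenspace A a != 0%VS -> leigenspace A a = leigenspace A b -> a = b.
Proof.
move=> nz ab; have := memv_pick (leigenspace A a); rewrite -vpick0 in nz.
rewrite {2}ab; move: (mem_leigenspace A b (vpick (leigenspace A a))) => ->.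
have := memv_pick (leigenspace A a); rewrite mem_leigenspace => /eqP -> /eqP.
move/eqP; rewrite -subr_eq0 -scalerBl scaler_eq0 (negPf nz) orbF subr_eq0.
by move/eqP.
Qed.

Lemma eigenvalues_unique A d (W : 'I_d.+1 -> {vspace V})
    (E : 'I_d.+1 -> 'End(V)) (x y : nat -> F) :
  eigenspace_ordering A W -> primitive_idempotents W E ->
  (forall i : 'I_d.+1, limg (E i) = leigenspace A (x i)) ->
  (forall i : 'I_d.+1, limg (E i) = leigenspace A (y i)) ->
  forall i, (i <= d)%N -> x i = y i.
Proof.
move=> Weig EW xE yE i; rewrite -ltnS => lti.
have [WE nz] := limg_idempotent Weig EW (Ordinal lti).
apply: (@leigenspace_inj A); first by rewrite -(xE (Ordinal lti)) WE.
by rewrite -(xE (Ordinal lti)) -(yE (Ordinal lti)).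
Qed.

Lemma eq_shift_prod A (x y : nat -> F) hs :
  {in hs, x =1 y} -> shift_prod A x hs = shift_prod A y hs.
Proof. by move=> xy; apply: eq_big_seq => h /xy ->. Qed.

Variables (d : nat) (Phi : sysdata V d).

Lemma eigenvalue_sequence_inj theta i j : tridiagonal_system Phi ->
  eigenvalue_sequence Phi theta -> (i <= d)%N -> (j <= d)%N ->
  theta i = theta j -> i = j.
Proof.
case=> _ [W [Word _] EW] _ thE; rewrite -ltnS => lti; rewrite -ltnS => ltj eq_th.
have limgE := limg_idempotent Word EW.
suff [] : Ordinal lti = Ordinal ltj by [].
by apply: (proj1 Word); rewrite -!(proj1 (limgE _)) !thE /= eq_th.
Qed.

Lemma split_sequence_unique zeta zeta' : tridiagonal_system Phi ->
  split_sequence Phi zeta -> split_sequence Phi zeta' ->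
  forall i, (i <= d)%N -> zeta i = zeta' i.
Proof.
case=> _ [W [Word _] EW] [Ws [Wsord _] EWs].
case=> th [ths [thE thsE zE]] [th' [ths' [thE' thsE' zE']]] i le_id.
have eq_th := eigenvalues_unique Word EW thE thE'.
have eq_ths := eigenvalues_unique Wsord EWs thsE thsE'.
have [WsE nz] := limg_idempotent Wsord EWs ord0; rewrite -WsE -vpick0 in nz.
have v_in := memv_pick (limg (sysEs Phi ord0)).
have : zeta i *: vpick (limg (sysEs Phi ord0)) =
       zeta' i *: vpick (limg (sysEs Phi ord0)).
  rewrite -zE // -zE' // /split_op; congr (_ _); congr (_ \o _)%VF.
    apply: eq_shift_prod => h; rewrite mem_index_iota ltnS => /andP[_ le_hi].
    exact/eq_ths/(leq_trans le_hi).
  apply: eq_shift_prod => h; rewrite mem_rev mem_index_iota => /= lt_hi.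
  exact/eq_th/(leq_trans (ltnW lt_hi)).
by move/eqP; rewrite -subr_eq0 -scalerBl scaler_eq0 (negPf nz) orbF subr_eq0 =>
  /eqP.
Qed.
End Eigenspaces.

(** * The roots of the Drinfel'd polynomial *)

Theorem proposition10p9
  (F : fieldType) (L : closedFieldType) (emb : {rmorphism F -> L})
  (HL : is_algebraic_closure emb)
  (V : vectType F) (HV : (0 < \dim {:V})%N)
  (d : nat) (Phi : sysdata V d) (HPhi : leonard_system Phi)
  (beta : F) (HII : type_II Phi beta)
  (theta thetas : nat -> F)
  (Htheta : eigenvalue_sequence Phi theta)
  (Hthetas : dual_eigenvalue_sequence Phi thetas)
  (a b c a_s b_s c_s : F)
  (Habc : forall i, (i <= d)%N ->
     theta i = a + b * (i%:R - d%:R / 2%:R) + c * i%:R * (d%:R - i%:R))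
  (Habcs : forall i, (i <= d)%N ->
     thetas i = a_s + b_s * (i%:R - d%:R / 2%:R) + c_s * i%:R * (d%:R - i%:R))
  (varphi phi : nat -> F)
  (Hvarphi : first_split_sequence Phi varphi)
  (Hphi : second_split_sequence Phi phi)
  (t : L)
  (Hvarphit : forall i, (1 <= i <= d)%N ->
     emb (varphi i) = i%:R * (d%:R - i%:R + 1) *
       (t - emb (b * b_s) / 2%:R
          + emb (b * c_s + c * b_s) * (i%:R - (d%:R + 1) / 2%:R)
          - emb (c * c_s) * (i%:R - (d%:R + 1) / 2%:R) ^+ 2))
  (Hphit : forall i, (1 <= i <= d)%N ->
     emb (phi i) = i%:R * (d%:R - i%:R + 1) *
       (t + emb (b * b_s) / 2%:R
          + emb (c * b_s - b * c_s) * (i%:R - (d%:R + 1) / 2%:R)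
          - emb (c * c_s) * (i%:R - (d%:R + 1) / 2%:R) ^+ 2))
  (zeta : nat -> F) (Hzeta : split_sequence Phi zeta) :
  let P := map_poly emb (drinfeld_poly d b c b_s c_s zeta) in
  (c * c_s != 0 -> forall psi : L,
     psi ^+ 2 = 4%:R * t * emb (c * c_s)
                + emb (b ^+ 2 * c_s ^+ 2) + emb (b_s ^+ 2 * c ^+ 2) ->
     roots_are P
       [seq t + psi * (i%:R - (d%:R + 1) / 2%:R)
            + emb (c * c_s) * (i%:R - (d%:R + 1) / 2%:R) ^+ 2
       | i <- index_iota 1 d.+1]) /\
  (c * c_s = 0 ->
     roots_are P
       [seq t + emb (b * c_s + c * b_s) * (i%:R - (d%:R + 1) / 2%:R)
       | i <- index_iota 1 d.+1]).
Proof.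
have [triPhi _] := HPhi.
have nz2F : 2%:R != 0 :> F by have [_ _] := HII; rewrite inE /=.
have nz2 : 2%:R != 0 :> L by rewrite -(rmorph_nat emb) fmorph_eq0.
have nz_fact : d`!%:R ^+ 2 != 0 :> L.
  suff nzf i : (i <= d)%N -> i`!%:R != 0 :> L by rewrite expf_neq0 ?nzf.
  elim: i => [|i IHi] lt_id; first by rewrite oner_neq0.
  rewrite factS natrM mulf_neq0 ?IHi ?(ltnW lt_id) //.
  rewrite -(rmorph_nat emb) fmorph_eq0; apply/eqP => i0.
  suff: i.+1 = 0%N by [].
  apply: (eigenvalue_sequence_inj triPhi Htheta) => //.
  by rewrite !Habc // i0; ring.
have zetaE i : (i <= d)%N -> zeta i = \prod_(1 <= h < i.+1) varphi h.
  exact: (split_sequence_unique triPhi Hzeta Hvarphi).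
set e := emb (b * b_s) / 2%:R; set s := emb (b * c_s + c * b_s).
set k := emb (c * c_s).
have factor psi :
    k != 0 /\ psi ^+ 2 = 4%:R * t * k + s ^+ 2 - 4%:R * e * k \/
      k = 0 /\ psi = s ->
    roots_are (map_poly emb (drinfeld_poly d b c b_s c_s zeta))
       [seq t + psi * (i%:R - (d%:R + 1) / 2%:R)
            + k * (i%:R - (d%:R + 1) / 2%:R) ^+ 2
       | i <- index_iota 1 d.+1].
  move=> kpsi.
  rewrite [map_poly _ _](_ : _ = d`!%:R ^+ 2 *: \prod_(1 <= h < d.+1)
    ((t + psi * (h%:R - (d%:R + 1) / 2%:R)
        + k * (h%:R - (d%:R + 1) / 2%:R) ^+ 2)%:P - 'X)).
    exact: roots_are_prod.
  rewrite -(split_sum_factor d nz2 kpsi).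
  rewrite /drinfeld_poly rmorph_sum; apply: eq_big_nat => i.
  rewrite ltnS => /andP[_ le_id]; rewrite /= map_polyZ rmorph_prod zetaE //.
  rewrite rmorph_prod; congr (_ *: _).
    apply: eq_big_nat => h; rewrite ltnS => /andP[h_gt0 le_hi].
    by rewrite Hvarphit // h_gt0 (leq_trans le_hi).
  apply: eq_bigr => h _; rewrite /phat /= map_polyZ rmorphB /= map_polyC map_polyX.
  congr (_ *: (_%:P - _)); first by rewrite rmorphXn rmorph_nat.
  by rewrite /e /s /k; field.
split=> [nzk psi psiE | k0].
  apply: factor; left; split; first by rewrite fmorph_eq0.
  by rewrite psiE /k /s /e; field.
have kL : k = 0 by rewrite /k k0 rmorph0.
have := factor s (or_intror (conj kL erefl)).
by under eq_map => i do rewrite kL mul0r addr0.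
Qed.
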